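(* Let $x\in\mathrm{Dom}(\Phi)$. Suppose the function $u:\mathrm{Gr}(\Phi)\to\overline{\mathbb{R}}$ is feasible path transfer upper semicontinuous on $\mathrm{Gr}_{\{x\}}(\Phi)$ and $\mathbb{K}\mathbb{N}$-inf-compact on $\mathrm{Gr}_{\{x\}}(\Phi)$. Then the function $u^*:\mathrm{Dom}(\Phi)\to\overline{\mathbb{R}}$ is continuous at $x$. If $u^*(x)=+\infty$, then $\Phi^*(x)=\Phi(x)$. Otherwise, $\Phi^*$ is upper semicontinuous at $x$, and $\Phi^*(x)$ is nonempty and compact.
   Context: $X,Y$ are topological spaces, $\Phi:X\to 2^Y$ is a multifunction ($\Phi(x)\subset Y$, possibly empty), $\mathrm{Dom}(\Phi)=\{x\in X:\Phi(x)\ne\emptyset\}$, $\mathrm{Gr}_E(\Phi)=\{(x,y)\in E\times Y: y\in\Phi(x)\}$ for $E\subset X$, $\mathrm{Gr}(\Phi)=\mathrm{Gr}_X(\Phi)$. $u:\mathrm{Gr}(\Phi)\to\overline{\mathbb{R}}=\mathbb{R}\cup\{\pm\infty\}$. For $x\in\mathrm{Dom}(\Phi)$: $u^*(x)=\inf_{y\in\Phi(x)}u(x,y)$ and $\Phi^*(x)=\{y\in\Phi(x):u(x,y)=u^*(x)\}$. A neighborhood of $x$ is an open subset of $X$ containing $x$. A function $f:E\to\overline{\mathbb{R}}$ is lower semicontinuous (lsc) at $z\in E$ if $f(z)\le\liminf_\alpha f(z_\alpha)$ for every net $(z_\alpha)$ in $E$ with $z_\alpha\to z$; it is upper semicontinuous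 (usc) at $z$ if $-f$ is lsc at $z$; continuous if both. The multifunction $\Phi^*$ is upper semicontinuous at $x$ if for each open $V\subset Y$ with $\Phi^*(x)\subset V$ there is a neighborhood $U$ of $x$ with $\Phi^*(x')\subset V$ for all $x'\in U\cap\mathrm{Dom}(\Phi)$. Feasible path transfer upper semicontinuity: for $E\subset\mathrm{Dom}(\Phi)$, $u$ is feasible path transfer upper semicontinuous on $\mathrm{Gr}_E(\Phi)$ if for each $x\in E$, $y\in\Phi(x)$ and $\gamma\in\mathbb{R}$ with $u(x,y)<\gamma$ there is a neighborhood $U$ of $x$ such that for each $x'\in U$ there exists $y'\in\Phi(x')$ with $u(x',y')<\gamma$. $\mathbb{K}\mathbb{N}$-inf-compactness: for $E\subset\mathrm{Dom}(\Phi)$, $u$ is $\mathbb{K}\mathbb{N}$-inf-compact on $\mathrm{Gr}_E(\Phi)$ if (i) $u$ is lsc (as a function on $\mathrm{Gr}(\Phi)$) at each $(x,y)\in\mathrm{Gr}_E(\Phi)$; and (ii) if a net $(x_\alpha)_{\alpha\in I}$ in $\mathrm{Dom}(\Phi)$ converges to $x\in E$, then each net $(y_\alpha)_{\alpha\in I}$ with $y_\alpha\in\Phi(x_\alpha)$ for all $\alpha$ such that $\{u(x_\alpha,y_\alpha)\}_{\alpha\in I}$ is bounded above has an accumulation point $y\in\Phi(x)$. *)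

(* Defs.v *)
From mathcomp Require Import all_boot all_order all_algebra.
From mathcomp Require Import all_classical all_reals.
From mathcomp Require Import ereal topology normedtype.

Set Implicit Arguments.
Unset Strict Implicit.
Unset Printing Implicit Defensive.

Import Order.TTheory GRing.Theory Num.Theory.

Local Open Scope classical_set_scope.
Local Open Scope ereal_scope.

Record directedSet := DirectedSet {
  dir_sort :> Type;
  dir_le : dir_sort -> dir_sort -> Prop;
  dir_point : dir_sort;
  dir_refl : forall a, dir_le a a;
  dir_trans : forall a b c, dir_le a b -> dir_le b c -> dir_le a c;
  dir_ub : forall a b, exists c, dir_le a c /\ dir_le b c }.

(* A net in T is a function z : I -> T with I : directedSet; it is handled
   through its filter [z @ tails I], so that [z @ tails I --> t] is net
   convergence and [cluster (z @ tails I)] is the set of its accumulation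
   points (see net_cvgP and net_clusterP below). *)
Definition tails (I : directedSet) : set_system I :=
  filter_from setT (fun a : I => [set b | dir_le a b]).
Arguments tails : clear implicits.

#[global] Instance tails_filter (I : directedSet) : ProperFilter (tails I).
Proof.
apply: filter_from_proper; last by move=> a _; exists a; exact: dir_refl.
apply: filter_from_filter; first by exists (dir_point I).
move=> a b _ _; have [c [ac bc]] := dir_ub a b.
by exists c => // d cd; split; apply: dir_trans cd.
Qed.

Lemma net_cvgP (T : topologicalType) (I : directedSet) (z : I -> T) (t : T) :
  z @ tails I --> t <->
  forall U : set T, open_nbhs t U ->
    exists a, forall b, dir_le a b -> U (z b).
Proof.
split=> [zt U oU|H U].
  by have [a _ aU] := zt U (open_nbhs_nbhs oU); exists a.
rewrite nbhsE => -[V oV VU]; have [a aV] := H V oV.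
by exists a => // b /aV /VU.
Qed.

Lemma net_clusterP (T : topologicalType) (I : directedSet) (z : I -> T)
    (t : T) :
  cluster (z @ tails I) t <->
  forall U : set T, open_nbhs t U ->
    forall a, exists2 b, dir_le a b & U (z b).
Proof.
split=> [zt U oU a|H A U [a _ aA]].
  have [] := zt [set z b | b in [set b | dir_le a b]] U.
  - by exists a => // b ab; exists b.
  - exact: open_nbhs_nbhs.
  - by move=> _ [[b ab <-] Ub]; exists b.
rewrite nbhsE => -[V oV VU]; have [b ab Vb] := H V oV a.
by exists (z b); split; [exact: aA | exact: VU].
Qed.

Definition net_liminf (R : realType) (I : directedSet) (v : I -> \bar R) :
  \bar R := limf_einf (@idfun (\bar R)) (v @ tails I).

Lemma net_liminfE (R : realType) (I : directedSet) (v : I -> \bar R) :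
  net_liminf v =
  ereal_sup [set ereal_inf [set v b | b in [set b | dir_le a b]]
            | a in [set: I]].
Proof.
rewrite /net_liminf limf_einfE; apply/eqP; rewrite eq_le; apply/andP; split.
  apply: ge_ereal_sup => _ [V [a _ aV] <-].
  apply: le_trans; last by apply: ereal_sup_ubound; exists a.
  apply: ereal_inf_le_tmp => _ [b ab <-].
  by exists (v b) => //; exact: aV.
apply: ge_ereal_sup => _ [a _ <-]; apply: ereal_sup_ubound.
exists [set v b | b in [set b | dir_le a b]].
  by exists a => // b ab; exists b.
by rewrite image_id.
Qed.

Section Semicontinuity.
Context {T : topologicalType} {R : realType}.
Implicit Types (E : set T) (f : T -> \bar R).

(* A function on a subset E of T is represented by a total function on T of
   which only the values on E are used. *)
Definition lsc_at E f (t : T) : Prop :=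
  forall (I : directedSet) (z : I -> T),
    (forall a, E (z a)) -> z @ tails I --> t -> f t <= net_liminf (f \o z).

Definition usc_at E f (t : T) : Prop := lsc_at E (fun s => - f s) t.

Definition lsc_usc_at E f (t : T) : Prop := lsc_at E f t /\ usc_at E f t.

End Semicontinuity.

Section Multifunctions.
Context {X Y : topologicalType} {R : realType}.
Implicit Types (Phi : X -> set Y) (u : X * Y -> \bar R) (E : set X).

Definition Dom Phi : set X := [set x | Phi x !=set0].

Definition GrOn Phi E : set (X * Y) := [set p | E p.1 /\ Phi p.1 p.2].

Definition Gr Phi : set (X * Y) := GrOn Phi setT.

Definition ustar Phi u (x : X) : \bar R :=
  ereal_inf [set u (x, y) | y in Phi x].

Definition Phistar Phi u (x : X) : set Y :=
  [set y | Phi x y /\ u (x, y) = ustar Phi u x].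

Definition usc_multifun_at (D : set X) (Psi : X -> set Y) (x : X) : Prop :=
  forall V : set Y, open V -> Psi x `<=` V ->
    exists2 U : set X, open_nbhs x U &
      forall x', (U `&` D) x' -> Psi x' `<=` V.

Definition feasible_path_transfer_usc Phi u E : Prop :=
  forall x y (gamma : R), E x -> Phi x y -> u (x, y) < gamma%:E ->
    exists2 U : set X, open_nbhs x U &
      forall x', U x' -> exists2 y', Phi x' y' & u (x', y') < gamma%:E.

Definition KN_inf_compact Phi u E : Prop :=
  (forall p, GrOn Phi E p -> lsc_at (Gr Phi) u p) /\
  (forall (I : directedSet) (x_ : I -> X) (x : X),
     (forall a, Dom Phi (x_ a)) -> E x -> x_ @ tails I --> x ->
     forall y_ : I -> Y,
       (forall a, Phi (x_ a) (y_ a)) ->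
       (exists M : R, forall a, u (x_ a, y_ a) <= M%:E) ->
       exists2 y, Phi x y & cluster (y_ @ tails I) y).

End Multifunctions.

(* Main.v *)
Require Import Defs.
From mathcomp Require Import all_boot all_order all_algebra.
From mathcomp Require Import all_classical all_reals.
From mathcomp Require Import ereal topology normedtype.

(** The hypotheses speak of nets, the arguments are shorter with filters. Every
    proper filter containing a set [D] is the filter of tails of a net in [D]
    ([net_of_filter]), so lower semicontinuity becomes the usual neighbourhood
    condition ([lsc_atP]), and KN-inf-compactness becomes: a proper filter on
    the graph whose first projection converges to [x], and along which [u] is
    eventually bounded above, clusters at some [(x, y)] with [y] in [Phi x]
    ([KN_filter_cluster]). Lower semicontinuity of [u] bounds [u (x, y)] by any
    eventual upper bound of [u] along the filter ([lsc_le_cluster]); when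
    those bounds go down to [ustar Phi u x], the point [y] is a minimizer
    ([cluster_minimizer]).

    Each conclusion comes from choosing the filter.
    - [ustar] is lower semicontinuous: if, for some [gamma < ustar x], points
      arbitrarily close to [x] had [ustar <= gamma], then for [gamma'] strictly
      in between the graph points with [u <= gamma'] lying over neighbourhoods
      of [x] would cluster at a point over [x] of value at most [gamma'].
    - [ustar] is upper semicontinuous: this is feasible path transfer, which
      provides over each nearby point a value below [gamma > ustar x].
    - [Phistar] is upper semicontinuous: minimizers over points tending to [x]
      and lying outside an open [V] would cluster at a minimizer over [x]
      outside [V]; the upper semicontinuity of [ustar] supplies the bounds.
    - Nonemptiness and compactness of [Phistar x] use filters on the fibre
      over [x]: the sublevel sets above [ustar x], and any filter of
      minimizers.

    When [ustar x = +oo], every value of [u] over [x] is [+oo], so every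
    feasible point is a minimizer. *)

Set Implicit Arguments.
Unset Strict Implicit.
Unset Printing Implicit Defensive.

Import Order.TTheory GRing.Theory Num.Theory.

Local Open Scope classical_set_scope.
Local Open Scope ereal_scope.

(** Pointed members of the filter, ordered by reverse inclusion, index the net.
    Only members inside [D] are used, so that all the terms of the net are in
    [D] and not just the late ones. *)
Lemma net_of_filter (T : Type) (F : set_system T) (D : set T) :
  ProperFilter F -> F D ->
  exists (I : directedSet) (z : I -> T),
    (forall a, D (z a)) /\ z @ tails I = F.
Proof.
move=> FF FD.
pose P (a : set T * T) := [/\ F a.1, a.1 `<=` D & a.1 a.2].
pose le (a b : {a | P a}) := (sval b).1 `<=` (sval a).1.
have [p0 Dp0] := filter_ex FD.
have P0 : P (D, p0) by split.
have le_refl a : le a a by move=> ?.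
have le_trans a b c : le a b -> le b c -> le a c by move=> ab bc t /bc /ab.
have le_ub a b : exists c, le a c /\ le b c.
  have [FA AD _] := svalP a; have [FB _ _] := svalP b.
  have FAB : F ((sval a).1 `&` (sval b).1) by exact: filterI.
  have [r ABr] := filter_ex FAB.
  have Pr : P ((sval a).1 `&` (sval b).1, r) by split => //= t [/AD].
  by exists (exist _ _ Pr); split => t [].
exists (DirectedSet (exist _ _ P0) le_refl le_trans le_ub).
exists (fun a : {a | P a} => (sval a).2); split.
  by move=> a; have [_ AD Aa] := svalP a; exact: AD.
apply/seteqP; split => [A [[[B p] PBp] _ BA]|A FA].
  have [/= FB BD _] := PBp; apply: (filterS _ FB) => q Bq.
  have Pq : P (B, q) by split.
  exact: (BA (exist _ _ Pq) (fun _ => id)).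
have FAD : F (A `&` D) by exact: filterI.
have [r ADr] := filter_ex FAD.
have Pr : P (A `&` D, r) by split => //= t [].
exists (exist _ _ Pr) => // b BAD.
by have [_ _ /BAD[]] := svalP b.
Qed.

Lemma ereal_between (R : realType) (a b : \bar R) :
  a < b -> exists r : R, a < r%:E < b.
Proof.
case: a b => [a| |] [b| |] //.
- rewrite lte_fin => ab; exists ((a + b) / 2)%R.
  by rewrite !lte_fin midf_lt//= midf_lt.
- by move=> _; exists (a + 1)%R; rewrite lte_fin ltrDl ltr01 ltry.
- by move=> _; exists (b - 1)%R; rewrite lte_fin gtrBl ltr01 ltNyr.
- by move=> _; exists 0%R; rewrite ltNyr ltry.
Qed.

Lemma le_real_above (R : realType) (a b : \bar R) :
  (forall r : R, b < r%:E -> a <= r%:E) -> a <= b.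
Proof.
move=> H; rewrite leNgt; apply/negP => /ereal_between[r /andP[br ra]].
by have := H r br; rewrite leNgt ra.
Qed.

(** From nets to neighbourhoods: were the condition to fail, the trace of the
    neighbourhoods of [t] on the sublevel set at [gamma] would be a proper
    filter, hence given by a net tending to [t] inside that sublevel set, whose
    lower limit is too small. *)
Lemma lsc_atP (T : topologicalType) (R : realType) (E : set T)
    (f : T -> \bar R) (t : T) :
  lsc_at E f t <->
  forall gamma : R, gamma%:E < f t ->
    \forall s \near t, E s -> gamma%:E < f s.
Proof.
split=> [lscf gamma gft|nearf I z Ez zt].
  apply: contrapT => nnear.
  pose D := E `&` [set s | f s <= gamma%:E].
  have FF : ProperFilter (within D (nbhs t)).
    apply: Build_ProperFilter; rewrite /within /= => D0; apply: nnear.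
    apply: filterS D0 => s Ds Es; rewrite ltNge; apply/negP => fs.
    exact: Ds.
  have FD : within D (nbhs t) D by exact: withinT.
  have [I [z [Dz zF]]] := net_of_filter FF FD.
  have zt : z @ tails I --> t by rewrite zF; exact: cvg_within.
  have := lscf I z (fun a => (Dz a).1) zt.
  apply/negP; rewrite -ltNge; apply: le_lt_trans gft.
  rewrite net_liminfE; apply: ge_ereal_sup => _ [a _ <-].
  apply: le_trans (Dz a).2.
  by apply: ereal_inf_lbound; exists a => //; exact: dir_refl.
rewrite leNgt; apply/negP => /ereal_between[r /andP[lr rf]].
have [a _ ar] := zt _ (nearf r rf).
move: lr; apply/negP; rewrite -leNgt net_liminfE.
apply: le_trans; last by apply: ereal_sup_ubound; exists a.
by apply: le_ereal_inf_tmp => _ [b ab <-]; apply/ltW/ar.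
Qed.

(** Sublevel sets of a lower semicontinuous function are closed. Stating this
    for a cluster point, rather than a limit, avoids refining the filter, so
    that the same cluster point serves for all bounds [gamma] at once. *)
Lemma lsc_le_cluster (T : topologicalType) (R : realType) (E : set T)
    (f : T -> \bar R) (t : T) (F : set_system T) (gamma : R) :
  Filter F -> lsc_at E f t -> F E -> cluster F t ->
  F [set s | f s <= gamma%:E] -> f t <= gamma%:E.
Proof.
move=> FF /lsc_atP lscf FE clFt Ff.
rewrite leNgt; apply/negP => /lscf near_t.
have [s [[Es fs] /(_ Es)]] := clFt _ _ (filterI FE Ff) near_t.
by rewrite ltNge fs.
Qed.

(** The filter generated by the traces on [B] of the sets [U `*` setT], with [U]
    a neighbourhood of [x]. To prove that something holds near [x], one refutes
    that this filter is proper for the set [B] of counterexamples. *)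
Definition fibre_filter (X : topologicalType) (Y : Type) (x : X)
    (B : set (X * Y)) : set_system (X * Y) :=
  fun A => \forall z \near x, forall y, B (z, y) -> A (z, y).

Section FibreFilter.
Context {X : topologicalType} {Y : Type} (x : X) (B : set (X * Y)).

#[local] Instance fibre_filter_filter : Filter (fibre_filter x B).
Proof.
rewrite /fibre_filter; split=> /=; first exact: nearW.
- by move=> P Q; apply: filterS2 => z Pz Qz y Bzy; split; auto.
- by move=> P Q PQ; apply: filterS => z Pz y /Pz /PQ.
Qed.

Lemma fibre_filter_set : fibre_filter x B B.
Proof. exact: nearW. Qed.

Lemma fibre_filter_cvg_fst : fst @ fibre_filter x B --> x.
Proof.
by move=> A xA; apply: (@filterS _ (nbhs x) _ _ _ _ xA) => z Az y _.
Qed.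

Lemma fibre_filter_near (P : set X) :
  (\forall z \near x, P z) -> fibre_filter x B [set p | P p.1].
Proof. exact: fibre_filter_cvg_fst. Qed.

Lemma fibre_filter_proper :
  ~ (\forall z \near x, forall y, ~ B (z, y)) ->
  ProperFilter (fibre_filter x B).
Proof. by move=> nB; exact: Build_ProperFilter. Qed.

End FibreFilter.

Section Minimizers.
Context {R : realType} {X Y : topologicalType}.
Variables (Phi : X -> set Y) (u : X * Y -> \bar R) (x : X).
Hypothesis KNu : KN_inf_compact Phi u [set x].

Lemma ustar_le z y : Phi z y -> ustar Phi u z <= u (z, y).
Proof. by move=> Phizy; apply: ereal_inf_lbound; exists y. Qed.

(** The compactness condition only gives an accumulation point of the second
    coordinates. Since the first coordinates converge, not just accumulate, the
    pairs accumulate too, which is what semicontinuity of [u] can use. *)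
Lemma KN_filter_cluster (F : set_system (X * Y)) (M : R) :
  ProperFilter F -> F (Gr Phi) -> fst @ F --> x ->
  F [set p | u p <= M%:E] ->
  exists2 y, Phi x y & cluster F (x, y).
Proof.
move=> FF FG Fx FM.
have [I [z [GMz zF]]] := net_of_filter FF (filterI FG FM).
have Gz a : Phi (z a).1 (z a).2 by have [[]] := GMz a.
have zE a : z a = ((z a).1, (z a).2) by case: (z a).
have zx : (fst \o z) @ tails I --> x.
  by move=> A /Fx; rewrite -[in X in X -> _]zF.
have uM : exists M : R, forall a, u ((z a).1, (z a).2) <= M%:E.
  exists M => a; rewrite -zE; exact: (GMz a).2.
have [y Phixy cly] : exists2 y, Phi x y & cluster ((snd \o z) @ tails I) y.
  have Dz a : Dom Phi ((fst \o z) a) by exists (z a).2; exact: Gz.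
  exact: (KNu.2 I _ x Dz erefl zx (snd \o z) Gz uM).
exists y => // A B FA [[U V] [/= xU yV] UVB].
(* The first coordinate is eventually in [U], so a frequent visit of the second
   one to [V] is a frequent visit of the pair to [U `*` V]. *)
have FAU : F (A `&` [set p | U p.1]) by apply: filterI => //; exact: Fx.
have [] := cly (snd @` (A `&` [set p | U p.1])) V _ yV.
  rewrite -[in F _]zF in FAU.
  by apply: (@filterS _ (tails I) _ _ _ _ FAU) => a AUa; exists (z a).
move=> _ [[[z0 y0] /= [Ap Up] <-] Vp]; exists (z0, y0); split => //.
exact: UVB.
Qed.

(** The filter is a generalized minimizing sequence over points tending to [x];
    its cluster point has value at most every real above [ustar Phi u x]. The
    case [ustar Phi u x = -oo] is covered, because the bounds [gamma] are
    arbitrary reals above it, not [ustar Phi u x] plus a positive number. *)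
Lemma cluster_minimizer (F : set_system (X * Y)) :
  ProperFilter F -> F (Gr Phi) -> fst @ F --> x -> ustar Phi u x < +oo ->
  (forall gamma : R, ustar Phi u x < gamma%:E ->
     F [set p | u p <= gamma%:E]) ->
  exists2 y, Phistar Phi u x y & cluster F (x, y).
Proof.
move=> FF FG Fx /ereal_between[M /andP[uM _]] Fu.
have [y Phixy clxy] := KN_filter_cluster FF FG Fx (Fu _ uM).
exists y => //; split => //; apply/eqP; rewrite eq_le ustar_le// andbT.
apply: le_real_above => gamma /Fu.
by apply: lsc_le_cluster FG clxy; exact: KNu.1.
Qed.

(** Properness of the filter of graph points with [u <= M] over neighbourhoods
    of [x] is where [gamma < M] is needed: an infimum at most [gamma] need not
    be attained, but values at most [M] are. *)
Lemma ustar_lsc : lsc_at (Dom Phi) (ustar Phi u) x.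
Proof.
apply/lsc_atP => gamma /ereal_between[M /andP[gM Mu]].
apply: contrapT => nnear.
pose B : set (X * Y) := Gr Phi `&` [set p | u p <= M%:E].
have FF : ProperFilter (fibre_filter x B).
  apply: fibre_filter_proper => nB; apply: nnear.
  apply: filterS nB => z nBz _; apply: lt_le_trans gM _.
  apply: le_ereal_inf_tmp => _ [y Phizy <-]; rewrite leNgt.
  by apply/negP => /ltW uzM; exact: (nBz y).
have [FG FM] : fibre_filter x B (Gr Phi) /\
               fibre_filter x B [set p | u p <= M%:E].
  by split; apply: filterS (fibre_filter_set x B) => p [].
have [y Phixy clxy] := KN_filter_cluster FF FG (fibre_filter_cvg_fst B) FM.
have : u (x, y) <= M%:E by apply: lsc_le_cluster FG clxy FM; exact: KNu.1.
by rewrite leNgt (lt_le_trans Mu) ?ustar_le.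
Qed.

Hypothesis FPTu : feasible_path_transfer_usc Phi u [set x].

Lemma ustar_near_lt (gamma : R) : ustar Phi u x < gamma%:E ->
  \forall z \near x, ustar Phi u z < gamma%:E.
Proof.
move=> /ereal_inf_lt[_ [y Phixy <-] ug].
have [U oU HU] := FPTu erefl Phixy ug.
apply: filterS (open_nbhs_nbhs oU) => z /HU[y' Phizy'].
exact/le_lt_trans/ustar_le.
Qed.

Lemma ustar_usc : usc_at (Dom Phi) (ustar Phi u) x.
Proof.
apply/lsc_atP => gamma; rewrite lteNr -EFinN => /ustar_near_lt.
by apply: filterS => z; rewrite EFinN -lteNr.
Qed.

Hypothesis ux : ustar Phi u x < +oo.

(** Minimizers outside [V] over points near [x] have [u = ustar], so the upper
    semicontinuity of [ustar] makes them a minimizing filter; its cluster point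
    lies in [V], and [V] is a neighbourhood of it that they never enter. *)
Lemma Phistar_usc : usc_multifun_at (Dom Phi) (Phistar Phi u) x.
Proof.
move=> V oV PhiV.
suff : nbhs x [set z | Phistar Phi u z `<=` V].
  by rewrite nbhsE => -[U oU UV]; exists U => // z [/UV].
apply: contrapT => nnear.
pose B : set (X * Y) := [set p | Phistar Phi u p.1 p.2 /\ ~ V p.2].
have FF : ProperFilter (fibre_filter x B).
  apply: fibre_filter_proper => nB; apply: nnear.
  apply: filterS nB => z nBz y Pzy; apply: contrapT => nVy.
  exact: (nBz y).
have FB := fibre_filter_set x B.
have FG : fibre_filter x B (Gr Phi) by apply: filterS FB => p [[]].
have [||y /PhiV Vy clxy] := cluster_minimizer FF FG (fibre_filter_cvg_fst B).
- exact: ux.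
- move=> gamma /ustar_near_lt/(fibre_filter_near B).
  by apply: filterS2 FB => -[z y] [[_ /= uE] _] /ltW; rewrite -uE.
have [|[z y'] [[_ nVy'] [_ /nVy']]] // := clxy B (setT `*` V) FB.
by exists (setT, V) => //; split; [exact: filterT|exact: open_nbhs_nbhs].
Qed.

Lemma Phistar_nonempty : Phistar Phi u x !=set0.
Proof.
(* The levels are extended reals so that [+oo] witnesses that there is one. *)
pose S (gamma : \bar R) := [set p | [/\ p.1 = x, Phi x p.2 & u p <= gamma]].
pose F := filter_from [set gamma | ustar Phi u x < gamma] S.
have FF : ProperFilter F.
  apply: filter_from_proper.
    apply: filter_from_filter; first by exists +oo.
    move=> g h ug uh; exists (Order.min g h); first by rewrite /= lt_min ug uh.
    by move=> p [p1 Pp]; rewrite le_min => /andP[].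
  by move=> g /ereal_inf_lt[_ [y Phixy <-] /ltW ug]; exists (x, y).
have FS g : ustar Phi u x < g -> F (S g) by exists g.
have [||||y Py _] := cluster_minimizer FF; last by exists y.
- by apply: filterS (FS _ ux) => -[z y] [/= -> Phixy _].
- by move=> A /nbhs_singleton Ax; apply: filterS (FS _ ux) => p [/= ->].
- exact: ux.
- by move=> gamma /FS; apply: filterS => p [].
Qed.

(** A filter of minimizers, placed on the fibre over [x], is a minimizing filter
    on which [u] is constant. *)
Lemma Phistar_compact : compact (Phistar Phi u x).
Proof.
move=> G FG GP.
have FF : ProperFilter (pair x @ G) by exact: fmap_proper_filter.
have FP A : (forall y, Phistar Phi u x y -> A (x, y)) -> (pair x @ G) A.
  by move=> PA; apply: (@filterS _ G _ _ _ _ GP) => y /PA.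
have [||||y Py clxy] := cluster_minimizer FF.
- by apply: FP => y [].
- by move=> A /nbhs_singleton Ax; exact: FP.
- exact: ux.
- by move=> gamma /ltW ug; apply: FP => y [_ /= ->].
exists y; split => // A W GA yW.
have [||[z y'] [[y0 Ay0 [_ <-]] [_ Wy0]]] := clxy (pair x @` A) (setT `*` W).
- by apply: (@filterS _ G _ _ _ _ GA) => y' Ay'; exists y'.
- by exists (setT, W) => //; split => //; exact: filterT.
- by exists y0.
Qed.

End Minimizers.

Theorem theorem8 (R : realType) (X Y : topologicalType) (Phi : X -> set Y)
    (u : X * Y -> \bar R) (x : X) :
  Dom Phi x ->
  feasible_path_transfer_usc Phi u [set x] ->
  KN_inf_compact Phi u [set x] ->
  lsc_usc_at (Dom Phi) (ustar Phi u) x /\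
  (ustar Phi u x = +oo -> Phistar Phi u x = Phi x) /\
  (ustar Phi u x <> +oo ->
     usc_multifun_at (Dom Phi) (Phistar Phi u) x /\
     Phistar Phi u x !=set0 /\
     compact (Phistar Phi u x)).
Proof.
move=> _ FPTu KNu; split; first by split; [exact: ustar_lsc|exact: ustar_usc].
split=> [uoo|/eqP ux].
  apply/seteqP; split=> [y []//|y Phixy]; split => //.
  by apply/eqP; rewrite eq_le ustar_le// andbT uoo leey.
have {}ux : ustar Phi u x < +oo by rewrite ltey.
split; first exact: Phistar_usc.
by split; [exact: Phistar_nonempty|exact: Phistar_compact].
Qed.
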